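(* Let $n\ge 2$. The mapping $\Phi$, which sends an interval poset $P$ with $n$ minimal elements to the dissection $\Phi(P)$ of the convex $(n+1)$-gon, is a bijection from the set of interval posets with $n$ minimal elements to the set of diagonally framed dissections of the convex $(n+1)$-gon in which no quadrilateral is present. Consequently, these two sets have the same size.
   Context: Intervals and interval posets. For $\pi\in\mathcal{S}_n$, an interval of $\pi$ is a nonempty set of consecutive values $[a,b]=\{a,a+1,\dots,b\}\subseteq\{1,\dots,n\}$ that appear in consecutive positions of $\pi$ (in some order); $\{1,\dots,n\}$ and all singletons are intervals. The interval poset $P(\pi)$ is the set of all intervals of $\pi$ ordered by inclusion; its minimal elements are the $n$ singletons. An interval poset with $n$ minimal elements is a poset of the form $P(\pi)$ with $\pi\in\mathcal{S}_n$; it is regarded as a concrete family of subsets $[a,b]$ of $\{1,\dots,n\}$ (different permutations may give the same poset). Dissections. The vertices of the convex $(n+1)$-gon are labelled $1,\dots,n+1$ in cyclic order; $(i,j)$ denotes the segment (diagonal or outer edge) joining vertices $i$ and $j$. A dissection is a set of diagonals of the polygon; diagonals are allowed to cross. Two diagonals cross if they intersect at an interior point. The graph of the dissection has the polygon's vertices as vertex set, and its edges are the outer edges together with the diagonals of the dissection. A dissection is diagonally framed if, whenever two of its diagonals $(a,c)$ and $(b,d)$ cross, each of $(a,b),(b,c),(c,d),(d,a)$ is an edge of the graph of the dissection (i.e. an outer edge or a diagonal of the dissection). A quadrilateral of the dissection is a set of four vertices $a<b<c<d$ such that $(a,b),(b,c),(c,d),(a,d)$ are all edges of the graph of the dissection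 but neither $(a,c)$ nor $(b,d)$ is. The map $\Phi$. For an interval poset $P$ with $n$ minimal elements, $\Phi(P)$ is the dissection of the convex $(n+1)$-gon consisting of the diagonals $(a,b+1)$ for all non-singleton intervals $[a,b]\in P$ (the interval $[1,n]$ gives the outer edge $(1,n+1)$, and singletons $\{a\}$ correspond to the outer edges $(a,a+1)$). *)

(* Defs.v *)
From HB Require Import structures.
From mathcomp Require Import all_boot all_order all_algebra all_fingroup.
From mathcomp Require Import boolp classical_sets functions cardinality.

Set Implicit Arguments.
Unset Strict Implicit.
Unset Printing Implicit Defensive.

Import Order.TTheory GRing.Theory Num.Theory.

(* Values and positions are numbered from 0: the value v of {1, ..., n} is the
   element v - 1 of 'I_n, and the vertex i of the (n+1)-gon is the element
   i - 1 of 'I_n.+1. *)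

Definition itv (n : nat) (a b : 'I_n) : {set 'I_n} :=
  finset (fun x : 'I_n => a <= x <= b).

Definition consecutive (n : nat) (A : {set 'I_n}) : bool :=
  [exists a : 'I_n, exists b : 'I_n, (a <= b) && (A == itv a b)].

(* s i is the value at position i, so s @^-1: I is the set of positions of the
   values in I. *)
Definition is_interval (n : nat) (s : 'S_n) (I : {set 'I_n}) : bool :=
  consecutive I && consecutive (s @^-1: I)%SET.

Definition interval_poset (n : nat) (s : 'S_n) : {set {set 'I_n}} :=
  finset (is_interval s).

Definition interval_posets (n : nat) : set {set {set 'I_n}} :=
  [set P | exists s : 'S_n, P = interval_poset s]%classic.
Arguments interval_posets n : clear implicits.

(* The segment joining the vertices i and j of an m-gon. *)
Definition seg (m : nat) (i j : 'I_m) : {set 'I_m} := [set i; j]%SET.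

(* ordS is the cyclic successor, so this includes the edge closing the polygon. *)
Definition outer_edge (m : nat) (e : {set 'I_m}) : bool :=
  [exists i : 'I_m, e == seg i (ordS i)].

Definition diagonal (m : nat) (e : {set 'I_m}) : bool :=
  (#|e| == 2) && ~~ outer_edge e.

Definition dissection (m : nat) (D : {set {set 'I_m}}) : bool :=
  [forall e in D, diagonal e].

Definition graph_edge (m : nat) (D : {set {set 'I_m}}) (i j : 'I_m) : bool :=
  outer_edge (seg i j) || (seg i j \in D).

Section Geometry.
Local Open Scope ring_scope.

(* Twice the signed area of the triangle u v w. *)
Definition orient (R : realFieldType) (u v w : 'rV[R]_2) : R :=
  (v 0 0 - u 0 0) * (w 0 1 - u 0 1) - (v 0 1 - u 0 1) * (w 0 0 - u 0 0).

(* The points p 0, ..., p (m - 1) are the vertices of a (strictly) convex m-gon,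
   listed in cyclic order, either counterclockwise or clockwise. *)
Definition convex_polygon (R : realFieldType) (m : nat)
    (p : 'I_m -> 'rV[R]_2) : Prop :=
  (forall i j k : 'I_m, (i < j < k)%N -> 0 < orient (p i) (p j) (p k)) \/
  (forall i j k : 'I_m, (i < j < k)%N -> orient (p i) (p j) (p k) < 0).

Definition open_segment (R : realFieldType) (u v : 'rV[R]_2) : set 'rV[R]_2 :=
  [set x | exists t : R, 0 < t < 1 /\ x = (1 - t) *: u + t *: v]%classic.

(* The interior points of a convex polygon that lie on one of its diagonals are
   the points of that diagonal other than its endpoints. *)
Definition cross (R : realFieldType) (m : nat) (p : 'I_m -> 'rV[R]_2)
    (a c b d : 'I_m) : Prop :=
  seg a c <> seg b d /\
  exists x : 'rV[R]_2,
    open_segment (p a) (p c) x /\ open_segment (p b) (p d) x.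

End Geometry.

Definition diagonally_framed (R : realFieldType) (m : nat)
    (p : 'I_m -> 'rV[R]_2) (D : {set {set 'I_m}}) : Prop :=
  forall a b c d : 'I_m,
    seg a c \in D -> seg b d \in D -> cross p a c b d ->
    [/\ graph_edge D a b, graph_edge D b c, graph_edge D c d
      & graph_edge D d a].

Definition quadrilateral (m : nat) (D : {set {set 'I_m}})
    (a b c d : 'I_m) : Prop :=
  [/\ a < b, b < c & c < d] /\
  [/\ graph_edge D a b, graph_edge D b c, graph_edge D c d & graph_edge D a d] /\
  ~~ graph_edge D a c /\ ~~ graph_edge D b d.

Definition framed_quad_free_dissections (R : realFieldType) (m : nat)
    (p : 'I_m -> 'rV[R]_2) : set {set {set 'I_m}} :=
  [set D | [/\ dissection D, diagonally_framed p D
             & ~ exists a b c d : 'I_m, quadrilateral D a b c d]]%classic.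

(* The interval [a, b] goes to the segment joining the vertices a and b + 1, so
   the non-singleton intervals of P give diagonals, except for the whole set of
   values, which gives an outer edge. *)
Definition Phi (n : nat) (P : {set {set 'I_n}}) : {set {set 'I_n.+1}} :=
  finset (fun e : {set 'I_n.+1} => diagonal e &&
    [exists a : 'I_n, exists b : 'I_n,
      [&& a < b, itv a b \in P
        & e == seg (widen_ord (leqnSn n) a) (lift ord0 b)]]).

(* Main.v *)
Require Import Defs.
From HB Require Import structures.
From mathcomp Require Import all_boot all_order all_algebra all_fingroup.
From mathcomp Require Import boolp classical_sets functions cardinality.
From mathcomp Require Import zify ring lra.

Set Implicit Arguments.
Unset Strict Implicit.
Unset Printing Implicit Defensive.

(** Number the vertices of the polygon from 0 to n and read a segment joining
    x < y as the half-open interval [x, y) of values.  The edges of the graph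
    of Phi (P(pi)) are then exactly the intervals of pi.  Let [lt] be the order
    in which pi lists the values.  A set [x, y) of values is an interval of pi
    iff every value outside it precedes all of its elements or follows all of
    them, that is, iff it is a module of [lt] ([is_module]).  Everything is
    proved for modules of strict total orders on the values.

    Two diagonals cross iff their endpoints alternate (proved from the signs of
    the areas of triangles), that is, iff the two intervals overlap.  Being
    framed thus says that the edges are closed under union, intersection and
    difference of overlapping intervals, and having no quadrilateral says that
    of three consecutive intervals with an interval as union, some two
    neighbours have an interval as union.  Modules have both properties
    ([framed_module], [quad_free_module]): for the second, of three modules in
    a row, the middle one is next in [lt] to at least one of the others.
    Moreover the edges determine the intervals.  So Phi maps into the stated set
    of dissections and is injective.

    Surjectivity is [exists_realizing_order]: a family E of intervals with both
    properties is the family of modules of some order.  The order is built by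
    induction on an edge (i, j).  The interval [i, j) is cut into blocks, each
    block being a smaller edge, and the order is inflated: an order between the
    blocks is combined with the orders given by induction inside the blocks.
     - If some v splits (i, j), meaning that (i, v) and (v, j) are edges, the
       cuts are all such v.  Unions of consecutive blocks are the only edges
       inside (i, j) that are not within one block, and the blocks are put in
       increasing order.  No other module may appear, and this is ensured by
       reversing the order inside a block if its first element precedes its
       last one.
     - Otherwise the blocks are the maximal proper subedges, which do not
       overlap, and no union of several blocks is an edge except (i, j) itself.
       There cannot be two blocks, as they would give a split, nor three,
       because of the quadrilateral condition.  So there are at least four
       blocks, and they are ordered by a simple permutation, one without
       nontrivial intervals; increasing oscillations provide one for each
       length at least four ([oscillation_prime]). *)

(** * Modules of a total order on the values *)

Definition strict_order (lt : rel nat) : Prop :=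
  [/\ irreflexive lt, transitive lt & forall x y, x != y -> lt y x = ~~ lt x y].

(** The half-open interval [a, b) of values is a module of the window [i, j):
    an element of the window outside of [a, b) does not separate its elements.
    For a total order, this is the same as being convex. *)
Definition is_module (lt : rel nat) (i j a b : nat) : Prop :=
  forall x y z, a <= x < b -> a <= y < b -> i <= z < j -> ~~ (a <= z < b) ->
    lt z x = lt z y.

(** The two conditions on dissections, for the relation E x y, meant for x < y,
    of being joined by an edge of the graph. *)
Definition framed (n : nat) (E : nat -> nat -> Prop) : Prop :=
  forall i j k l, i < j -> j < k -> k < l -> l <= n ->
    E i k -> E j l -> [/\ E i j, E j k, E k l & E i l].

Definition quad_free (n : nat) (E : nat -> nat -> Prop) : Prop :=
  forall i j k l, i < j -> j < k -> k < l -> l <= n ->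
    E i j -> E j k -> E k l -> E i l -> E i k \/ E j l.

Definition realizes (lt : rel nat) (E : nat -> nat -> Prop) (i j : nat) :
    Prop :=
  forall a b, i <= a -> a < b -> b <= j -> (E a b <-> is_module lt i j a b).

Lemma strict_order_key (f : nat -> nat) :
  injective f -> strict_order (fun x y => f x < f y).
Proof.
move=> f_inj; split=> [x|y x z|x y]; first exact: ltnn.
  exact: ltn_trans.
move=> xy; have : f x <> f y by move/f_inj/eqP; rewrite (negPf xy).
lia.
Qed.

Lemma strict_order_rev lt : strict_order lt -> strict_order (fun x y => lt y x).
Proof.
case=> irr tr tot; split=> // [y x z yx zy|x y xy]; first exact: tr zy yx.
by rewrite tot // eq_sym.
Qed.

Lemma module_rev lt i j a b : strict_order lt ->
  is_module (fun x y => lt y x) i j a b <-> is_module lt i j a b.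
Proof.
by case=> _ _ tot; split=> mod x y z xab yab zij zab;
  have /= e := mod x y z xab yab zij zab;
  rewrite tot ?[RHS]tot ?e //; lia.
Qed.

(** Overlapping modules.  An element of one of them lying outside the other is
    compared in the same way with all of the other; comparisons are moved from
    one module to the other through an element of the intersection. *)
Lemma framed_module n lt : strict_order lt -> framed n (is_module lt 0 n).
Proof.
case=> _ _ tot i j k l ij jk kl ln ik jl.
split=> x y z xab yab zn zab.
- case: (boolP (i <= z < k)) => [zik|zik]; last by apply: ik => //; lia.
  rewrite tot ?[RHS]tot; try lia; congr (~~ _).
  rewrite (jl z k x) ?(jl z k y); try lia.
  rewrite tot ?[RHS]tot; try lia; congr (~~ _).
  by apply: ik; lia.
- case: (boolP (i <= z < k)) => zik; last by apply: ik; lia.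
  by apply: jl; lia.
- case: (boolP (j <= z < l)) => [zjl|zjl]; last by apply: jl => //; lia.
  rewrite tot ?[RHS]tot; try lia; congr (~~ _).
  rewrite (ik z i x) ?(ik z i y); try lia.
  rewrite tot ?[RHS]tot; try lia; congr (~~ _).
  by apply: jl; lia.
- suff zj w : i <= w < l -> lt z w = lt z j by rewrite !zj.
  move=> wil; case: (ltnP w k) => wk; first by apply: ik; lia.
  by apply: jl; lia.
Qed.

(** Of the three modules, represented by their first elements i, j and k, the
    middle one [j, k) is next to [i, j) unless k lies between them, and next to
    [k, l) unless i lies between those.  Both cannot occur at once. *)
Lemma quad_free_module n lt : strict_order lt -> quad_free n (is_module lt 0 n).
Proof.
move=> so i j k l ij jk kl ln mij mjk mkl mil; have [irr tr tot] := so.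
have [kij|kij] := eqVneq (lt k i) (lt k j).
  left; suff zx x z : i <= x < k -> 0 <= z < n -> ~~ (i <= z < k) ->
      lt z x = lt z i.
    by move=> x y z xik yik zn zik; rewrite !zx.
  move=> xik zn zik; case: (boolP (i <= z < l)) => [zil|zil];
    last by apply: mil; lia.
  case: (ltnP x j) => xj; first by apply: mij; lia.
  rewrite (mjk x j z); try lia.
  rewrite tot ?[RHS]tot; try lia; congr (~~ _).
  rewrite (mkl z k j) ?(mkl z k i); try lia.
  by rewrite tot ?[RHS]tot ?kij; lia.
have [ijk|ijk] := eqVneq (lt i k) (lt i j).
  right; suff zx x z : j <= x < l -> 0 <= z < n -> ~~ (j <= z < l) ->
      lt z x = lt z j.
    by move=> x y z xik yik zn zik; rewrite !zx.
  move=> xik zn zik; case: (boolP (i <= z < l)) => [zil|zil];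
    last by apply: mil; lia.
  case: (ltnP x k) => xk; first by apply: mjk; lia.
  rewrite (mkl x k z); try lia.
  rewrite tot ?[RHS]tot; try lia; congr (~~ _).
  rewrite (mij z i k) ?(mij z i j); try lia.
  by rewrite tot ?[RHS]tot ?ijk; lia.
move: (tot i j) (tot i k) (tot j k) kij ijk.
move: (tr i k j) (tr j i k) (tr j k i) (tr k j i) (tr i j k) (tr k i j).
case: (lt i j); case: (lt j i); case: (lt i k); case: (lt k i); case: (lt j k);
  case: (lt k j) => //=; lia.
Qed.

(** * Simple permutations of every length at least four *)

(** The increasing oscillation 1, 3, 0, 5, 2, 7, 4, ... of 0, ..., k - 1, given
    by the position of each value.  Its inversion graph is a path: an even v is
    inverted with v + 1 and v + 3 only.  If k is odd, cutting the sequence would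
    disconnect k - 1, so that value is moved just before k - 3, which makes
    {k - 3, k - 1} an inversion.  The offsets
    keep the positions of the three kinds of values apart modulo 4. *)
Definition oscillation (k v : nat) : nat :=
  if odd v then 4 * v else if v.+1 == k then 4 * v + 5 else 4 * v + 14.

Lemma oscillation_inj k : injective (oscillation k).
Proof.
move=> u v; rewrite /oscillation.
case: (boolP (odd u)) => ou; case: (boolP (odd v)) => ov; try lia.
- by case: (v.+1 =P k); lia.
- by case: (u.+1 =P k); lia.
- by case: (u.+1 =P k); case: (v.+1 =P k); lia.
Qed.

(** If an interval [p, q) with at least two elements is not [0, k), a value close
    to one of its ends separates two successive elements of it. *)
Lemma oscillation_prime k p q : 3 < k -> p.+1 < q -> q <= k ->
  is_module (fun x y => oscillation k x < oscillation k y) 0 k p q ->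
  p = 0 /\ q = k.
Proof.
move=> k4 pq qk mod; suff : ~ (0 < p \/ q < k) by lia.
have odd_osc v : odd v -> oscillation k v = 4 * v by rewrite /oscillation => ->.
have even_osc v : ~~ odd v -> v.+1 < k -> oscillation k v = 4 * v + 14.
  by rewrite /oscillation => /negPf-> vk; rewrite ltn_eqF.
have last_osc v : ~~ odd v -> v.+1 = k -> oscillation k v = 4 * v + 5.
  by rewrite /oscillation => /negPf-> ->; rewrite eqxx.
have nosep z x : z < k -> z < p \/ q <= z -> p <= x -> x.+1 < q ->
    (oscillation k z < oscillation k x) =
    (oscillation k z < oscillation k x.+1).
  by move=> *; apply: mod; lia.
case=> [p0|qk'].
  case: (boolP (odd p)) => op.
    (* the module is {k - 2, k - 1}, whose last element is the moved one *)
    have [pk|pk] := eqVneq p.+2 k.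
      have := nosep (p - 3) p.
      by rewrite (even_osc (p - 3)) ?(last_osc p.+1) ?(odd_osc p); lia.
    have := nosep p.-1 p.
    by rewrite (even_osc p.-1) ?(even_osc p.+1) ?(odd_osc p); lia.
  have := nosep (p - 2) p.
  by rewrite (even_osc (p - 2)) ?(even_osc p) ?(odd_osc p.+1); lia.
case: (boolP (odd q)) => oq.
  have := nosep q (q - 2).
  by rewrite (odd_osc q) ?(odd_osc (q - 2)) ?(even_osc (q - 2).+1); lia.
have [qk2|qk2] := eqVneq q.+1 k.
  have := nosep q (q - 2).
  by rewrite (last_osc q) ?(even_osc (q - 2)) ?(odd_osc (q - 2).+1); lia.
have := nosep q.+1 (q - 2).
by rewrite (odd_osc q.+1) ?(even_osc (q - 2)) ?(odd_osc (q - 2).+1); lia.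
Qed.

(** * Inflating an order on blocks *)

(** The cut points i = c 0 < c 1 < ... < c k = j divide [i, j) into k blocks, and
    idx x is the number of the block of x. *)
Definition cutting (i j k : nat) (c idx : nat -> nat) : Prop :=
  [/\ c 0 = i, c k = j, forall m m', m < m' -> m' <= k -> c m < c m'
    & forall x, i <= x < j -> idx x < k /\ c (idx x) <= x < c (idx x).+1].

Lemma exists_cutting (S : nat -> Prop) i j : i < j ->
  exists k c idx,
    [/\ 0 < k, cutting i j k c idx,
        forall m, 0 < m < k -> S (c m)
      & forall m v, m < k -> c m < v < c m.+1 -> ~ S v].
Proof.
elim: j => // j IH; rewrite ltnS leq_eqVlt => /predU1P[->{i IH}|ij].
  exists 1, (addn j), (fun=> 0); split=> //; last by lia.
    by split=> [|||x] /=; lia.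
  by lia.
have [k [c [idx [k0 [c0 ck cm idxP] cS cN]]]] := IH ij.
have [Sj|nSj] := EM (S j).
  exists k.+1, (fun m => if m <= k then c m else j.+1),
    (fun x => if x < j then idx x else k); split=> //.
  - split=> [|||x xij]; rewrite ?ltnn //.
      move=> m m' mm' m'k; rewrite (_ : m <= k); last by lia.
      case: (leqP m' k) => [|km]; first exact: (cm m m' mm').
      have [->|mk] := eqVneq m k; first by rewrite ck.
      have := cm m k; lia.
    case: (ltnP x j) => xj.
      have [|? ?] := idxP x; first lia.
      by rewrite !ifT; lia.
    by rewrite (leqnn k) ltnn ck; lia.
  - move=> m mk; rewrite ifT; last by lia.
    have [->|mk'] := eqVneq m k; first by rewrite ck.
    by apply: cS; lia.
  - move=> m v mk; rewrite (_ : m <= k); last by lia.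
    case: (leqP m.+1 k) => [mk'|km]; first by apply: cN.
    have -> : m = k by lia.
    by rewrite ck; lia.
exists k, (fun m => if m < k then c m else j.+1),
  (fun x => if x < j then idx x else k.-1); split=> //.
- split=> [|||x xij]; rewrite ?ltnn ?k0 //.
    move=> m m' mm' m'k; rewrite (_ : m < k); last by lia.
    case: (ltnP m' k) => [mk'|km]; first by apply: cm; lia.
    have := cm m k; lia.
  case: (ltnP x j) => xj.
    have [|xk xm] := idxP x; first lia.
    by rewrite xk; case: (ltnP (idx x).+1 k); lia.
  by rewrite prednK // ltnn leqnn; have := cm k.-1 k; lia.
- by move=> m mk; rewrite ifT; [apply: cS; lia|lia].
- move=> m v mk; rewrite mk.
  case: (ltnP m.+1 k) => [mk'|km] vm; first by apply: (cN m).
  have km' : m.+1 = k by lia.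
  have [->//|vj] := eqVneq v j.
  by apply: (cN m) => //; rewrite km' ck; lia.
Qed.

Section Gluing.

Variables (i j k : nat) (c idx : nat -> nat).
Hypothesis cutc : cutting i j k c idx.

Lemma cut_leq m m' : m <= m' -> m' <= k -> c m <= c m'.
Proof.
case: cutc => _ _ cm _; rewrite leq_eqVlt => /predU1P[->//|mm' m'k].
exact/ltnW/cm.
Qed.

Lemma cut_idx m x : m < k -> c m <= x < c m.+1 -> idx x = m.
Proof.
case: cutc => c0 ck cm idxP mk xm.
have [|idk xid] := idxP x.
  have := @cut_leq 0 m; have := @cut_leq m.+1 k; lia.
have := @cut_leq m.+1 (idx x); have := @cut_leq (idx x).+1 m; lia.
Qed.

Lemma cut_idx_mono x y : i <= x -> x <= y -> y < j -> idx x <= idx y.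
Proof.
case: cutc => c0 ck cm idxP ix xy yj.
have [|xk xm] := idxP x; first lia.
have [|yk ym] := idxP y; first lia.
case: leqP => // yx; have := @cut_leq (idx y).+1 (idx x); lia.
Qed.

Lemma cut_bounds m : m < k -> i <= c m /\ c m.+1 <= j.
Proof.
case: cutc => c0 ck cm _ mk.
have := @cut_leq 0 m; have := @cut_leq m.+1 k; lia.
Qed.

Variables (tau : rel nat) (lo : nat -> rel nat).

(** The inflation of a permutation, seen on orders: elements of different blocks
    are compared by [tau], elements of block m by [lo m]. *)
Definition inflate : rel nat := fun x y =>
  if idx x == idx y then lo (idx x) x y else tau (idx x) (idx y).

Hypothesis tau_so : strict_order tau.
Hypothesis lo_so : forall m, strict_order (lo m).

Lemma inflate_strict_order : strict_order inflate.
Proof.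
rewrite /inflate; have [tirr ttr ttot] := tau_so.
split=> [x|y x z|x y xy].
- by rewrite eqxx; have [irr _ _] := lo_so (idx x); rewrite irr.
- have [e|xy] := eqVneq (idx x) (idx y).
    by rewrite e; case: eqP => // _; have [_ tr _] := lo_so (idx y); apply: tr.
  have [<-|yz] := eqVneq (idx y) (idx z).
    by rewrite (negPf xy).
  have [<-|xz] := eqVneq (idx x) (idx z); last exact: ttr.
  by move=> lxy lyx; have := ttr _ _ _ lxy lyx; rewrite tirr.
- have [e|e] := eqVneq (idx x) (idx y); last by rewrite ttot.
  by rewrite e; have [_ _ ->] := lo_so (idx y).
Qed.

(** The elements of the window outside block m do not separate its elements. *)
Lemma inflate_block m a b : m < k -> c m <= a -> b <= c m.+1 ->
  is_module inflate i j a b <-> is_module (lo m) (c m) (c m.+1) a b.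
Proof.
move=> mk ma bm; have [im mj] := cut_bounds mk.
have idm x : c m <= x < c m.+1 -> idx x = m by exact: cut_idx.
split=> mod x y z xab yab zij zab.
  by have := mod x y z xab yab; rewrite /inflate !idm ?eqxx; [apply; lia|lia..].
have [zm|zm] := boolP (c m <= z < c m.+1).
  by rewrite /inflate !idm ?eqxx; [apply: mod|lia..].
have zid : idx z != m.
  have [_ _ _ /(_ z zij) [_ zb]] := cutc.
  by apply: contraNneq zm => <-.
by rewrite /inflate !(idm x) ?(idm y) ?(negPf zid); lia.
Qed.

(** Thanks to [inflate_block], it remains to look at intervals that meet several
    blocks. *)
Lemma inflate_realizes E :
  (forall m, m < k -> realizes (lo m) E (c m) (c m.+1)) ->
  (forall a b, i <= a -> b <= j -> a < b -> idx a < idx b.-1 ->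
     (E a b <-> is_module inflate i j a b)) ->
  realizes inflate E i j.
Proof.
move=> inner spanning a b ia ab bj.
have ab1 : idx a <= idx b.-1 by apply: cut_idx_mono; lia.
case: (ltnP (idx a) (idx b.-1)) => [|ba]; first exact: spanning.
have [_ _ _ idxP] := cutc.
have [|ak am] := idxP a; first lia.
have [|bk bm] := idxP b.-1; first lia.
have e : idx b.-1 = idx a by lia.
rewrite e in bm; rewrite (inflate_block ak); [|lia|lia].
by apply: inner; lia.
Qed.

End Gluing.

(** If [u, v) were the union of two nonempty modules, the lower one placed first,
    then u would precede v - 1.  Thus a block with reversed ends cannot merge
    partially with its neighbours when blocks are put in increasing order. *)
Definition reversed_ends (lt : rel nat) u v := u.+1 < v -> lt v.-1 u.

(** * The case of an edge that is split *)

(** An edge that meets two blocks starts and ends at cuts: if it started inside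
    a block, framing would make its starting point a split.  A module that meets
    two blocks does so too, as the ends of the blocks are reversed. *)
Lemma inflate_linear n E i j k c idx lo :
    framed n E -> j <= n -> E i j ->
    cutting i j k c idx ->
    (forall m, 0 < m < k -> E i (c m) /\ E (c m) j) ->
    (forall m v, m < k -> c m < v < c m.+1 -> ~ (E i v /\ E v j)) ->
    (forall m, strict_order (lo m)) ->
    (forall m, m < k -> reversed_ends (lo m) (c m) (c m.+1)) ->
  forall a b, i <= a -> b <= j -> a < b -> idx a < idx b.-1 ->
     (E a b <-> is_module (inflate idx ltn lo) i j a b).
Proof.
move=> fr jn Eij cut cS cN lo_so lo_rev a b ia bj ab pq.
have mono := cut_idx_mono cut; have bounds := cut_bounds cut.
have idm := cut_idx cut.
have [c0 ck cm idxP] := cut.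
have [|pk ap] := idxP a; first lia.
have [|qk bq] := idxP b.-1; first lia.
set p := idx a in pq pk ap *; set q := idx b.-1 in pq qk bq *.
have pq_c : c p.+1 <= c q.
  by have [->//|pq'] := eqVneq p.+1 q; apply/ltnW/cm; lia.
have [ip pj] := bounds _ pk; have [iq qj] := bounds _ qk.
have cut_i m : m < k -> E i (c m.+1).
  move=> mk; have [->|mk'] := eqVneq m.+1 k; first by rewrite ck.
  by have [] := cS m.+1; lia || by [].
have cut_j m : m < k -> E (c m) j.
  by case: m => [|m] mk; [rewrite c0|have [] := cS m.+1 mk].
split=> [Eab|mod].
- have ap' : c p = a.
    apply/eqP; apply/negPn/negP => cpa.
    apply: (cN p a) => //; first lia.
    have [||||||Eia Eav _ _] := fr i a (c p.+1) b; try lia; try by [].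
      by apply: cut_i.
    split=> //.
    have [->//|bj'] := eqVneq j b.
    have [||||||_ _ _ //] := fr a (c p.+1) b j; try lia; try by [].
    by apply: cut_j; lia.
  have bq' : c q.+1 = b.
    apply/eqP; apply/negPn/negP => cpa.
    apply: (cN q b) => //; first lia.
    have [||||||_ Eub Ebj _] := fr a (c q) b j; try lia; try by [].
      by apply: cut_j; lia.
    split=> //.
    have [->//|ia'] := eqVneq i a.
    have [||||||_ _ _ //] := fr i a (c q) b; try lia; try by [].
    by have := @cut_i q.-1; rewrite prednK; [apply; lia|lia].
  have idab x : a <= x < b -> p <= idx x <= q by move=> xab; rewrite !mono; lia.
  have side z : i <= z < j -> ~~ (a <= z < b) ->
      forall x, a <= x < b -> inflate idx ltn lo z x = (z < a).
    move=> zij zab x xab; have := idab x xab; have [zk zm] := idxP z zij.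
    have := cut_leq cut (m := p) (m' := idx z); rewrite /inflate.
    have := cut_leq cut (m := (idx z).+1) (m' := q.+1).
    by have [e|e] := eqVneq (idx z) (idx x) => /=; lia.
  by move=> x y z xab yab zij zab; rewrite !side.
have ap' : c p = a.
  apply/eqP; apply/negPn/negP => cpa.
  have in_p x : c p <= x < c p.+1 -> idx x = p by exact: idm.
  have := mod a b.-1 (c p); rewrite /inflate (in_p (c p)); last lia.
  rewrite -/p -/q eqxx (ltn_eqF pq) /= pq => E1.
  have := mod a (c p.+1).-1 (c p); rewrite /inflate !in_p ?eqxx; try lia.
  move=> E2; have {}E2 : lo p (c p) (c p.+1).-1 by rewrite -E2 ?E1; lia.
  have [irr tr _] := lo_so p; have := irr (c p).
  by rewrite (tr (c p.+1).-1) // lo_rev //; lia.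
have bq' : c q.+1 = b.
  apply/eqP; apply/negPn/negP => cpa.
  have in_q x : c q <= x < c q.+1 -> idx x = q by exact: idm.
  have := mod a (c q) (c q.+1).-1.
  rewrite /inflate (in_q (c q)) ?(in_q (c q.+1).-1); try lia.
  rewrite -/p eqxx (gtn_eqF pq) /= (ltnNge q p) (ltnW pq) /= => E1.
  by have := lo_rev q qk; rewrite /reversed_ends -E1; lia.
have Eib : E i b by rewrite -bq'; exact: cut_i.
have Eaj : E a j by rewrite -ap'; exact: cut_j.
have [->//|ia'] := eqVneq a i.
have [->//|bj'] := eqVneq b j.
by have [||||||_ _ _ //] := fr i a b j; lia || by [].
Qed.

(** * The case of an edge that is not split *)

(** The vertex v is not strictly inside an edge other than (i, j): it is a vertex
    of the face of the polygon next to (i, j). *)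
Definition prime_cut (E : nat -> nat -> Prop) i j v : Prop :=
  forall a b, i <= a -> a < v < b -> b <= j -> E a b -> a = i /\ b = j.

(** In the absence of splits, a longest proper subedge (l, r) containing x ends
    at cuts.  Indeed an edge (a, b) containing l strictly inside either contains
    (l, r) or, by framing, has the edge (a, r) as union with it.  This edge is
    longer, and if it were (i, j), then l would be a split. *)
Lemma maximal_proper n E i j x :
    framed n E -> j <= n -> (forall v, i < v < j -> ~ (E i v /\ E v j)) ->
    i <= x -> x < j -> i.+1 < j -> E x x.+1 ->
  exists l r, [/\ i <= l <= x, x < r <= j, E l r, ~ (l = i /\ r = j)
    & (l = i \/ prime_cut E i j l) /\ (r = j \/ prime_cut E i j r)].
Proof.
move=> fr jn nosplit ix xj ij Exx.
suff ext d l r : j - i - (r - l) <= d -> i <= l <= x -> x < r <= j -> E l r ->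
    ~ (l = i /\ r = j) ->
    exists l r, [/\ i <= l <= x, x < r <= j, E l r, ~ (l = i /\ r = j)
      & (l = i \/ prime_cut E i j l) /\ (r = j \/ prime_cut E i j r)].
  by apply: (ext (j - i) x x.+1); lia || by [].
elim: d l r => [|d IH] l r lrd ilx xrj Elr lr; first lia.
have grow a b : i <= a <= l -> r <= b <= j -> b - a > r - l -> E a b ->
  ~ (a = i /\ b = j) ->
  exists l r, [/\ i <= l <= x, x < r <= j, E l r, ~ (l = i /\ r = j)
      & (l = i \/ prime_cut E i j l) /\ (r = j \/ prime_cut E i j r)].
  by move=> *; apply: (IH a b); lia || by [].
have [lcut|/not_orP[li /existsNP[a /existsNP[b]]]] :=
  EM (l = i \/ prime_cut E i j l); last first.
  move=> /not_implyP[ia /not_implyP[alb /not_implyP[bj /not_implyP[Eab ab]]]].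
  have [rb|br] := leqP r b; first by apply: (grow a b); lia || by [].
  have [||||||Eal Elb Ebr Ear] := fr a l b r; try lia; try by [].
  apply: (grow a r); try lia; try by [].
  by move=> [ai rj]; apply: (nosplit l); [lia|rewrite -{1}ai -rj].
have [rcut|/not_orP[rj /existsNP[a /existsNP[b]]]] :=
  EM (r = j \/ prime_cut E i j r); last first.
  move=> /not_implyP[ia /not_implyP[alb /not_implyP[bj /not_implyP[Eab ab]]]].
  have [rb|br] := leqP a l; first by apply: (grow a b); lia || by [].
  have [||||||Ela Ear Erb Elb] := fr l a r b; try lia; try by [].
  apply: (grow l b); try lia; try by [].
  by move=> [li bj']; apply: (nosplit r); [lia|rewrite -{1}li -bj'].
by exists l, r.
Qed.

(** The longest proper subedge containing c m has no cut strictly inside and ends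
    at cuts, so it is block m. *)
Lemma prime_block n E i j k c idx :
    framed n E -> j <= n -> (forall v, i < v < j -> ~ (E i v /\ E v j)) ->
    i.+1 < j -> (forall x, i <= x < j -> E x x.+1) ->
    cutting i j k c idx ->
    (forall m, 0 < m < k -> prime_cut E i j (c m)) ->
    (forall m v, m < k -> c m < v < c m.+1 -> ~ prime_cut E i j v) ->
  forall m, m < k -> E (c m) (c m.+1) /\ ~ (c m = i /\ c m.+1 = j).
Proof.
move=> fr jn nosplit ij Exx cut cS cN m mk.
have [c0 ck cm _] := cut; have [im mj] := cut_bounds cut mk.
have := cm m m.+1; rewrite ltnSn => /(_ isT mk) cmm.
have [||||l [r [lm mr Elr lr [lcut rcut]]]] :=
  @maximal_proper n E i j (c m) fr jn nosplit;
  try lia; first by apply: Exx; lia.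
have lm' : l = c m.
  apply/eqP/negPn/negP => nlm.
  have m0 : 0 < m by case: (m) lm nlm => [|//]; rewrite c0; lia.
  have [|||||li rj] := cS m _ l r; try lia; try by [].
have rm' : r = c m.+1.
  have rm : c m.+1 <= r.
    rewrite leqNgt; apply/negP => rm; case: rcut => [|rcut]; first lia.
    by apply: (cN m r) => //; lia.
  apply/eqP/negPn/negP => nrm.
  have m1k : m.+1 < k.
    rewrite ltn_neqAle mk andbT; apply: contra_neq nrm => e.
    by rewrite e ck in rm *; lia.
  have [|||||li rj] := cS m.+1 _ l r; try lia; try by [].
by rewrite -lm' -rm'.
Qed.

(** The block numbers of a module that meets two blocks form a module of [tau],
    so the module meets all the blocks.  If it missed the element i, this element
    would not separate the blocks 1, ..., k - 1, which would be a nontrivial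
    module of [tau]; the same holds at the other end. *)
Lemma inflate_prime E i j k c idx tau lo :
    E i j -> cutting i j k c idx ->
    (forall m, 0 < m < k -> prime_cut E i j (c m)) -> 2 < k ->
    (forall p q, p.+1 < q -> q <= k -> is_module tau 0 k p q ->
       p = 0 /\ q = k) ->
  forall a b, i <= a -> b <= j -> a < b -> idx a < idx b.-1 ->
     (E a b <-> is_module (inflate idx tau lo) i j a b).
Proof.
move=> Eij cut cS k2 tau_prime a b ia bj ab pq.
have mono := cut_idx_mono cut; have bounds := cut_bounds cut.
have idm := cut_idx cut; have c_leq := cut_leq cut.
have [c0 ck cm idxP] := cut.
have [|pk ap] := idxP a; first lia.
have [|qk bq] := idxP b.-1; first lia.
set p := idx a in pq pk ap *; set q := idx b.-1 in pq qk bq *.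
split=> [Eab|mod].
  have cpq := c_leq p.+1 q pq (ltnW qk).
  have [|||||-> ->] := cS p.+1 _ a b; try lia; try by [].
  by move=> x y z; lia.
have rep m : p <= m <= q -> exists2 x, a <= x < b & idx x = m.
  move=> pmq; exists (maxn a (c m)).
    by have := c_leq m q; lia.
  apply: idm; first lia.
  have [->|/eqP pm] := eqVneq m p; first lia.
  by have := c_leq p.+1 m; have := cm m m.+1; lia.
have side w x y : i <= w < j -> ~~ (a <= w < b) -> p <= x <= q -> p <= y <= q ->
    idx w != x -> idx w != y -> tau (idx w) x = tau (idx w) y.
  move=> wij wab /rep[x' x'ab <-] /rep[y' y'ab <-] wx wy.
  have := mod x' y' w x'ab y'ab wij wab.
  by rewrite /inflate (negPf wx) (negPf wy).
have [|||p0 q1] := tau_prime p q.+1; try lia.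
  move=> x y z xpq ypq zk zpq.
  have [iz jz] := bounds z ltac:(lia).
  have cz := cm z z.+1 ltac:(lia) ltac:(lia).
  have <- : idx (c z) = z by apply: idm; lia.
  apply: side; try lia.
  - have [zp|zq] : z < p \/ q < z by lia.
      by have := cm z p; lia.
    by have := c_leq q.+1 z; lia.
  - by rewrite (idm z); lia.
  - by rewrite (idm z); lia.
have ai : a = i.
  apply/eqP/negPn/negP => ai.
  have idi : idx i = 0 by apply: idm; have := cm 0 1; lia.
  have [|||//] := tau_prime 1 k; try lia.
  move=> x y z xk yk zk z1; have -> : z = 0 by lia.
  by rewrite -idi; apply: side; lia.
have bj' : b = j.
  apply/eqP/negPn/negP => bj'.
  have idj : idx j.-1 = k.-1.
    by apply: idm; have := cm k.-1 k; rewrite ?prednK; lia.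
  have [|||_ ] := tau_prime 0 k.-1; try lia.
  move=> x y z xk yk zk z1; have -> : z = k.-1 by lia.
  by rewrite -idj; apply: side; lia.
by rewrite ai bj'.
Qed.

(** * Every framed family without quadrilaterals comes from an order *)

Lemma realizes_rev lt E i j : strict_order lt ->
  realizes lt E i j -> realizes (fun x y => lt y x) E i j.
Proof. by move=> so re a b ia ab bj; rewrite module_rev //; exact: re. Qed.

(** Induction on the length of the edge (i, j).  Orders given by induction may be
    reversed, so all blocks are given reversed ends, as the split case requires. *)
Theorem exists_realizing_order n E :
    framed n E -> quad_free n E -> (forall x, x < n -> E x x.+1) ->
  forall i j, i < j -> j <= n -> E i j ->
    exists lt, strict_order lt /\ realizes lt E i j.
Proof.
move=> fr qf Exx i j.
have [d] := ubnP (j - i); elim: d i j => // d IH i j jid ij jn Eij.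
have [ij1|ij1] := leqP j i.+1.
  exists ltn; split; first exact: (@strict_order_key id).
  move=> a b ia ab bj; have -> : a = i by lia.
  have -> : b = j by lia.
  by split=> // _ x y z; lia.
have IHrev u v : i <= u -> u < v -> v <= j -> ~ (u = i /\ v = j) -> E u v ->
    exists lt, [/\ strict_order lt, realizes lt E u v & reversed_ends lt u v].
  move=> iu uv vj uvij Euv; have [||||lt [so re]] := IH u v; try lia; try by [].
  have [lvu|nlvu] := boolP (lt v.-1 u); first by exists lt; split=> // _.
  exists (fun x y => lt y x).
  split; [exact: strict_order_rev|exact: realizes_rev|].
  by move=> uv'; have [_ _ ->] := so; [|lia].
have blocks k (c : nat -> nat) :
    (forall m, m < k -> [/\ i <= c m, c m < c m.+1, c m.+1 <= j,
       ~ (c m = i /\ c m.+1 = j) & E (c m) (c m.+1)]) ->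
  exists lo : nat -> rel nat, [/\ forall m, strict_order (lo m),
     forall m, m < k -> realizes (lo m) E (c m) (c m.+1)
   & forall m, m < k -> reversed_ends (lo m) (c m) (c m.+1)].
  move=> cE; have /choice[lo loP] : forall m, exists lt : rel nat,
      strict_order lt /\
      (m < k -> realizes lt E (c m) (c m.+1) /\ reversed_ends lt (c m) (c m.+1)).
    move=> m; have [mk|km] := ltnP m k.
      by have [im mm mj mij Em] := cE m mk;
        have [lt [so re rv]] := IHrev _ _ im mm mj mij Em; exists lt.
    by exists ltn; split=> //; exact: (@strict_order_key id).
  exists lo; split=> m; first by case: (loP m).
    by case: (loP m) => _ /[apply] -[].
  by case: (loP m) => _ /[apply] -[].
have [[v [ivj Eiv Evj]]|nosplit] :=
  EM (exists v, [/\ i < v < j, E i v & E v j]).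
  have [k [c [idx [k0 cut cS cN]]]] :=
    exists_cutting (fun v => E i v /\ E v j) ij.
  have [c0 ck cm idxP] := cut.
  have cE m : m < k -> [/\ i <= c m, c m < c m.+1, c m.+1 <= j,
       ~ (c m = i /\ c m.+1 = j) & E (c m) (c m.+1)].
    move=> mk; have [im mj] := cut_bounds cut mk.
    have cmm : c m < c m.+1 by apply: cm.
    have ncm : ~ (c m = i /\ c m.+1 = j).
      by move=> [e1 e2]; apply: (cN m v) => //; lia.
    split=> //.
    have E1 : E i (c m.+1).
      have [->|mk'] := eqVneq m.+1 k; first by rewrite ck.
      by have [] := cS m.+1; lia || by [].
    have E2 : E (c m) j.
      by case: (m) mk => [|m'] mk; [rewrite c0|have [] := cS m'.+1 mk].
    have [->//|ia'] := eqVneq (c m) i.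
    have [->//|bj'] := eqVneq (c m.+1) j.
    by have [||||||_ _ _ //] := fr i (c m) (c m.+1) j; lia || by [].
  have [lo [lo_so lo_re lo_rev]] := blocks k c cE.
  exists (inflate idx ltn lo); split.
    by apply: inflate_strict_order => //; exact: (@strict_order_key id).
  apply: (inflate_realizes cut) => //.
  exact: (inflate_linear fr jn Eij cut cS cN lo_so lo_rev).
have {}nosplit v : i < v < j -> ~ (E i v /\ E v j).
  by move=> ivj [Eiv Evj]; apply: nosplit; exists v.
have [k [c [idx [k0 cut cS cN]]]] := exists_cutting (prime_cut E i j) ij.
have [c0 ck cm idxP] := cut.
have cE m : m < k -> [/\ i <= c m, c m < c m.+1, c m.+1 <= j,
       ~ (c m = i /\ c m.+1 = j) & E (c m) (c m.+1)].
  move=> mk; have [im mj] := cut_bounds cut mk.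
  have [|Em mij] := prime_block fr jn nosplit ij1 _ cut cS cN mk.
    by move=> x xij; apply: Exx; lia.
  by split=> //; apply: cm.
(* one block would be (i, j), two would be a split, three a quadrilateral *)
have k3 : 3 < k.
  rewrite ltnNge; apply/negP => k3.
  have [_ c01 _ n0 E0] := cE 0 k0; rewrite c0 in n0 E0 c01.
  have [k1|k1] := eqVneq k 1; first by apply: n0; rewrite -k1 ck.
  have [|_ c12 _ _ E1] := cE 1; first lia.
  have [k2|k2] := eqVneq k 2.
    apply: (nosplit (c 1)); first by rewrite -ck k2; have := cm 1 2; lia.
    by split=> //; rewrite -ck k2.
  have [|_ c23 _ _ E2] := cE 2; first lia.
  have e3 : c 3 = j by rewrite -ck; congr c; lia.
  rewrite e3 in c23 E2.
  have [||||||||E02|E13] := qf i (c 1) (c 2) j; try lia; try by []; last first.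
    by apply: (nosplit (c 1)); [lia|].
  by apply: (nosplit (c 2)); [lia|].
have [lo [lo_so lo_re lo_rev]] := blocks k c cE.
exists (inflate idx (fun x y => oscillation k x < oscillation k y) lo); split.
  apply: inflate_strict_order => //; apply: strict_order_key.
  exact: oscillation_inj.
apply: (inflate_realizes cut) => //.
apply: (inflate_prime lo Eij cut cS); first lia.
by move=> p q pq qk; exact: oscillation_prime.
Qed.

(** * Intervals of a permutation as modules *)

Lemma consecutiveP n (A : {set 'I_n}) :
  reflect ((exists x, x \in A) /\
           forall x y z : 'I_n, x \in A -> y \in A -> x <= z <= y -> z \in A)
    (consecutive A).
Proof.
apply: (iffP existsP) => [[a /existsP[b /andP[ab /eqP->]]]|[[x0 x0A] A_ivl]].
  split=> [|x y z]; first by exists a; rewrite inE leqnn.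
  by rewrite !inE; lia.
case: (arg_minnP (P := mem A) val x0A) => a aA a_min.
case: (arg_maxnP (P := mem A) val x0A) => b bA b_max.
exists a; apply/existsP; exists b; rewrite a_min //=.
apply/eqP/setP => x; rewrite inE; apply/idP/idP => [xA|]; last exact: A_ivl.
by rewrite a_min //; exact: b_max.
Qed.

(** As s maps positions to values, s^-1 x is the position of the value x. *)
Lemma interval_poset_module n (s : 'S_n) (lt : rel nat) (a b : 'I_n) :
    (forall x y : 'I_n, lt x y = ((s^-1)%g x < (s^-1)%g y)) -> a <= b ->
  itv a b \in interval_poset s <-> is_module lt 0 n a b.+1.
Proof.
move=> ltE ab; rewrite inE /is_interval.
have -> : consecutive (itv a b).
  by apply/existsP; exists a; apply/existsP; exists b; rewrite ab eqxx.
have pos (x : 'I_n) : s ((s^-1)%g x) = x by rewrite permKV.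
split=> [/consecutiveP[_ cvx] x y z xab yab zn zab|mod].
  have xn : x < n by have := ltn_ord b; lia.
  have yn : y < n by have := ltn_ord b; lia.
  rewrite (ltE (Ordinal zn) (Ordinal xn)) (ltE (Ordinal zn) (Ordinal yn)).
  set x' := Ordinal xn; set y' := Ordinal yn; set z' := Ordinal zn.
  have nz u v : u \in itv a b -> v \in itv a b ->
      ~ ((s^-1)%g u <= (s^-1)%g z' <= (s^-1)%g v).
    move=> uI vI uzv; have := cvx _ _ _ _ _ uzv.
    by rewrite !inE !pos /= in uI vI *; move=> /(_ uI vI); lia.
  have xI : x' \in itv a b by rewrite inE.
  have yI : y' \in itv a b by rewrite inE.
  by have := nz _ _ xI yI; have := nz _ _ yI xI; lia.
apply/consecutiveP; split.
  by exists ((s^-1)%g a); rewrite !inE pos leqnn.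
move=> x y z; rewrite !inE => xab yab xzy; apply/negPn/negP => zab.
have := mod (s x) (s y) (s z); rewrite !ltE !permK.
have zx : z <> x by move=> zx; rewrite zx in zab; lia.
have zy : z <> y by move=> zy; rewrite zy in zab; lia.
have {}zx : z <> x :> nat by move/val_inj.
have {}zy : z <> y :> nat by move/val_inj.
by have := ltn_ord (s z); lia.
Qed.

(** The order of the positions, extended to all natural numbers because
    [strict_order] speaks of all of them. *)
Lemma perm_order n (s : 'S_n) : exists lt : rel nat,
  strict_order lt /\ forall x y : 'I_n, lt x y = ((s^-1)%g x < (s^-1)%g y).
Proof.
pose key x := if insub x is Some v then val ((s^-1)%g (v : 'I_n)) else x.
have keyE (v : 'I_n) : key v = (s^-1)%g v by rewrite /key valK.
have key_out x : n <= x -> key x = x.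
  by move=> nx; rewrite /key insubF // ltnNge nx.
exists (fun x y => key x < key y); split=> [|x y]; last by rewrite !keyE.
apply: strict_order_key => x y.
have [xn|nx] := ltnP x n; have [yn|ny] := ltnP y n.
- rewrite (keyE (Ordinal xn)) (keyE (Ordinal yn)) => /val_inj /perm_inj.
  by move/(congr1 val).
- rewrite (keyE (Ordinal xn)) (key_out y) // => e.
  by have := ltn_ord ((s^-1)%g (Ordinal xn)); lia.
- rewrite (keyE (Ordinal yn)) (key_out x) // => e.
  by have := ltn_ord ((s^-1)%g (Ordinal yn)); lia.
- by rewrite !key_out.
Qed.

(** The position of a value is the number of values before it. *)
Lemma order_perm n (lt : rel nat) : strict_order lt -> exists s : 'S_n,
  forall x y : 'I_n, lt x y = ((s^-1)%g x < (s^-1)%g y).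
Proof.
move=> [irr tr tot].
pose below (v : 'I_n) := finset (fun y : 'I_n => lt y v).
have rank_lt v : #|below v| < n.
  rewrite -[X in _ < X]card_ord -cardsT; apply: proper_card.
  by apply/properP; split; [exact: finset.subsetT|exists v; rewrite !inE ?irr].
pose rank v := Ordinal (rank_lt v).
have rank_mono (x y : 'I_n) : lt x y -> rank x < rank y.
  move=> xy; apply: proper_card; apply/properP; split.
    by apply/fintype.subsetP => z; rewrite !inE => zx; exact: tr zx xy.
  by exists x; rewrite !inE ?irr.
have rank_le (x y : 'I_n) : lt x y = (rank x < rank y).
  apply/idP/idP => [|rxy]; first exact: rank_mono.
  have [e|xy] := eqVneq (val x) y; first by rewrite (val_inj e) ltnn in rxy.
  apply/negPn/negP; rewrite -tot // => /rank_mono; lia.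
have rank_inj : injective rank.
  move=> x y e; apply/val_inj/eqP/negPn/negP => xy.
  have := tot _ _ xy; rewrite !rank_le e ltnn; lia.
exists (perm rank_inj)^-1%g => x y.
by rewrite invgK !permE.
Qed.

(** * Diagonals cross iff their endpoints alternate *)

Section Geometry.
Local Open Scope ring_scope.
Import Order.TTheory GRing.Theory Num.Theory.

Lemma open_segment_sym (R : realFieldType) (u v : 'rV[R]_2) :
  open_segment u v = open_segment v u.
Proof.
have half (a b : 'rV[R]_2) x : open_segment a b x -> open_segment b a x.
  case=> t [t01 ->]; exists (1 - t); split; first (case/andP: t01; lra).
  by rewrite addrC; congr (_ *: _ + _); ring.
by apply/funext => x; apply/propext; split; exact: half.
Qed.

Lemma orient_segment (R : realFieldType) (u v b d : 'rV[R]_2) t :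
  orient u v ((1 - t) *: b + t *: d) =
  (1 - t) * orient u v b + t * orient u v d.
Proof. rewrite /orient !mxE; ring. Qed.

Lemma orient_line (R : realFieldType) (u v : 'rV[R]_2) t :
  orient u v ((1 - t) *: u + t *: v) = 0.
Proof. rewrite /orient !mxE; ring. Qed.

(** The line through the vertices a and c separates the vertices between them
    from the others; the sign e = 1 or -1 accounts for the orientation of the
    polygon. *)
Lemma convex_side (R : realFieldType) m (p : 'I_m -> 'rV[R]_2) :
  convex_polygon p -> exists e : R, forall a c b : 'I_m, (a < c)%N ->
    let f := e * orient (p a) (p c) (p b) in
    [/\ (0 < f) = (b < a)%N || (c < b)%N, (f < 0) = (a < b < c)%N
      & (f == 0) = (b == a) || (b == c)].
Proof.
have orientC (u v w : 'rV[R]_2) : orient u w v = - orient u v w.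
  rewrite /orient; ring.
have orient_rot (u v w : 'rV[R]_2) : orient u v w = orient v w u.
  rewrite /orient; ring.
move=> hp; have [e he] : exists e : R, forall i j k : 'I_m, (i < j < k)%N ->
    0 < e * orient (p i) (p j) (p k).
  by case: hp => hp; [exists 1|exists (-1)] => i j k /hp;
    rewrite ?mul1r ?mulN1r ?oppr_gt0.
exists e => a c b ac f.
have f_out : (b < a)%N || (c < b)%N -> 0 < f.
  case/orP => [ba|cb]; last by apply: he; rewrite ac.
  by rewrite /f -orient_rot he // ba.
have f_in : (a < b < c)%N -> f < 0.
  by move=> abc; rewrite /f orientC mulrN oppr_lt0 he.
have f_on : (b == a) || (b == c) -> f = 0.
  case/orP => /eqP bE; rewrite /f bE /orient; ring.
clearbody f; have [on|off] := boolP ((b == a) || (b == c)).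
  rewrite (f_on on) ltxx eqxx; split=> //.
    by case/orP: on => /eqP->; move: ac; clear; lia.
  by case/orP: on => /eqP->; move: ac; clear; lia.
have [bin|bout] := boolP (a < b < c)%N.
  have f0 := f_in bin; rewrite f0 ltNge (ltW f0) lt_eqF //; split=> //.
  by move: bin; clear; lia.
have bout' : (b < a)%N || (c < b)%N.
  move: off bout; rewrite -!val_eqE /=; clear; lia.
have f0 := f_out bout'.
by rewrite f0 bout' (ltNge f) (ltW f0) gt_eqF.
Qed.

Lemma convex_combination_eq0 (R : realFieldType) (t x y : R) :
  0 < t < 1 -> (1 - t) * x + t * y = 0 ->
  [\/ 0 < x /\ y < 0, x < 0 /\ 0 < y | x = 0 /\ y = 0].
Proof.
case/andP=> t0 t1 e.
have [x0|x0|x0] := ltgtP x 0.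
- by constructor 2; split=> //; nra.
- by constructor 1; split=> //; nra.
- constructor 3; split=> //; move: e; rewrite x0 mulr0 add0r => /eqP.
  by rewrite mulf_eq0 gt_eqF //= => /eqP.
Qed.

(** The area of p a, p c and a point is an affine function of this point and is
    zero at the crossing, so it has opposite signs at p b and p d. *)
Lemma cross_interleaved (R : realFieldType) m (p : 'I_m -> 'rV[R]_2)
    (a c b d : 'I_m) :
  convex_polygon p -> (a < c)%N -> (b < d)%N -> cross p a c b d ->
  (a < b < c)%N && (c < d)%N || (b < a < d)%N && (d < c)%N.
Proof.
move=> /convex_side[e side] ac bd [nseg [x [[s [_ xac]] [t [t01 xbd]]]]].
have := orient_line (p a) (p c) s; rewrite -xac xbd orient_segment => ft.
have [b_out b_in b_on] := side a c b ac.
have [d_out d_in d_on] := side a c d ac.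
have eft : (1 - t) * (e * orient (p a) (p c) (p b)) +
    t * (e * orient (p a) (p c) (p d)) = 0.
  by transitivity (e * 0); [rewrite -ft; ring|rewrite mulr0].
case: (convex_combination_eq0 t01 eft) => -[fb fd].
- rewrite b_out in fb; rewrite d_in in fd.
  by move: fb fd ac bd; clear; lia.
- rewrite b_in in fb; rewrite d_out in fd.
  by move: fb fd ac bd; clear; lia.
- move/eqP: fb; move/eqP: fd; rewrite b_on d_on => hd hb.
  exfalso; apply: nseg; move: bd.
  case/orP: hb => /eqP->; case/orP: hd => /eqP-> //.
  + by rewrite ltnn.
  + by move: ac; clear; lia.
  + by rewrite ltnn.
Qed.

(** By Cramer's rule, the two lines meet at a point whose coordinates along the
    segments are ratios of areas; convexity places these ratios in ]0, 1[. *)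
Lemma interleaved_cross (R : realFieldType) m (p : 'I_m -> 'rV[R]_2)
    (i j k l : 'I_m) :
  convex_polygon p -> (i < j)%N -> (j < k)%N -> (k < l)%N -> cross p i k j l.
Proof.
move=> /convex_side[e side] ij jk kl; split.
  move/setP/(_ i); rewrite !inE eqxx /= => /esym/orP[]/eqP e1;
    by rewrite e1 in ij; lia.
have [_ A0 _] := side i k j (ltn_trans ij jk).
have [B0 _ _] := side i k l (ltn_trans ij jk).
have [C0 _ _] := side j l i (ltn_trans jk kl).
have [_ D0 _] := side j l k (ltn_trans jk kl).
rewrite {}ij {}jk {}kl ?orbT /= in A0 B0 C0 D0; move: D0 C0 B0 A0.
set A := orient _ _ (p j); set B := orient _ _ (p l).
set C := orient _ _ (p i); set D := orient _ _ (p k) => D0 C0 B0 A0.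
(* both differences are the cross product of the two diagonals *)
have ABCD : C - D = B - A by rewrite /A /B /C /D /orient; ring.
have e0 : e * (B - A) > 0 by rewrite mulrBr; lra.
have BA0 : B - A != 0 by apply: contraTneq e0 => ->; rewrite mulr0 ltxx.
have eV0 x : 0 < e * x -> 0 < x / (B - A).
  move=> ex; rewrite -[_ / _](_ : (e * x) / (e * (B - A)) = _);
    first exact: divr_gt0.
  have : e != 0 by apply: contraTneq e0 => ->; rewrite mul0r ltxx.
  by move=> en; field; rewrite en BA0.
have unit_frac x y : x + y = B - A -> 0 < e * x -> 0 < e * y ->
    0 < x / (B - A) < 1.
  move=> xy x0 y0; rewrite eV0 //=; have := eV0 y y0.
  rewrite (_ : y = (B - A) - x); last by rewrite -xy; ring.
  by rewrite mulrBl divff //; lra.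
exists ((1 - C / (B - A)) *: p i + (C / (B - A)) *: p k); split.
  exists (C / (B - A)); split=> //.
  by apply: (unit_frac _ (- D)); rewrite -?ABCD //; lra.
exists (- A / (B - A)); split.
  by apply: (unit_frac _ B); [ring|lra..].
have colE q : ((1 - C / (B - A)) *: p i + (C / (B - A)) *: p k) 0 q =
      ((1 - - A / (B - A)) *: p j + (- A / (B - A)) *: p l) 0 q.
  rewrite !mxE.
  suff : (B - A - C) * p i 0 q + C * p k 0 q = B * p j 0 q - A * p l 0 q.
    move=> h; apply: (mulfI BA0).
    transitivity ((B - A - C) * p i 0 q + C * p k 0 q); first by field.
    by rewrite h; field.
  have /orP[] : (q == 0) || (q == 1) by case: q => [[|[|]]].
    by move/eqP->; rewrite /A /B /C /orient; ring.
  by move/eqP->; rewrite /A /B /C /orient; ring.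
by apply/rowP.
Qed.

End Geometry.

(** * Dissections as relations between vertices *)

Lemma seg_sym m (i j : 'I_m) : seg i j = seg j i.
Proof. exact: finset.setUC. Qed.

Lemma seg_inj m (i j k l : 'I_m) :
  i < j -> k < l -> seg i j = seg k l -> i = k /\ j = l.
Proof.
move=> ij kl e; move/setP: e => e.
have := e i; have := e j; have := e k; rewrite !inE !eqxx -!val_eqE /=.
by move=> ? ? ?; split; apply: val_inj => /=; lia.
Qed.

Lemma graph_edge_sym m (D : {set {set 'I_m}}) i j :
  graph_edge D i j = graph_edge D j i.
Proof. by rewrite /graph_edge seg_sym. Qed.

Lemma outer_edge_seg n (i j : 'I_n.+1) : i < j ->
  outer_edge (seg i j) =
  (j == i.+1 :> nat) || ((i == 0 :> nat) && (j == n :> nat)).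
Proof.
move=> ij; apply/existsP/idP => [[k /eqP]|].
  have [kn|kn] := ltnP k n.
    move=> /seg_inj-/(_ ij) []; last by move=> -> ->; rewrite /= modn_small ?eqxx.
    by rewrite /= modn_small.
  have ek : k = n :> nat by have := ltn_ord k; lia.
  rewrite (seg_sym k) => /seg_inj-/(_ ij) [].
    by rewrite /= ek modnn; have := ltn_ord j; lia.
  by move=> -> ->; rewrite /= ek modnn !eqxx orbT.
case/orP=> [/eqP ji|/andP[/eqP i0 /eqP jn]].
  exists i; apply/eqP; congr seg; apply: val_inj.
  by rewrite /= modn_small ?ji // -ji.
exists j; rewrite seg_sym; apply/eqP; congr seg; apply: val_inj.
by rewrite /= jn modnn.
Qed.

Lemma diagonal_seg m (i j : 'I_m) : i < j -> Defs.diagonal (seg i j) = ~~ outer_edge (seg i j).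
Proof. by move=> ij; rewrite /Defs.diagonal cards2 -val_eqE /= (ltn_eqF ij). Qed.

Lemma diagonalP m (e : {set 'I_m}) : Defs.diagonal e -> exists i j : 'I_m, i < j /\ e = seg i j.
Proof.
case/andP=> /cards2P[i [j [ij ->]]] _.
have [lij|lji|/val_inj eij] := ltngtP i j; last by rewrite eij eqxx in ij.
  by exists i, j.
by exists j, i; rewrite seg_sym.
Qed.

(** The graph of a dissection determines it, as no outer edge is a diagonal. *)
Lemma dissection_eq m (D1 D2 : {set {set 'I_m}}) :
    dissection D1 -> dissection D2 ->
    (forall i j : 'I_m, i < j -> graph_edge D1 i j = graph_edge D2 i j) ->
  D1 = D2.
Proof.
move=> /forall_inP d1 /forall_inP d2 D12.
suff eD e : Defs.diagonal e -> (e \in D1) = (e \in D2).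
  by apply/setP=> e; apply/idP/idP => eD'; [rewrite -eD ?d1|rewrite eD ?d2].
move=> de; have [i [j [ij eE]]] := diagonalP de; have := D12 i j ij.
rewrite eE in de *; rewrite /graph_edge; move: de; rewrite diagonal_seg //.
by move/negPf->.
Qed.

(** The edges of the graph as a relation on natural numbers, to which the theory
    of [framed] and [quad_free] applies; [inord] sends the numbers above n to 0,
    but these never occur. *)
Definition edges n (D : {set {set 'I_n.+1}}) (x y : nat) : Prop :=
  graph_edge D (inord x) (inord y).

Lemma edges_ord n (D : {set {set 'I_n.+1}}) (i j : 'I_n.+1) :
  edges D i j = graph_edge D i j.
Proof. by rewrite /edges !inord_val. Qed.

Lemma edges_outer n (D : {set {set 'I_n.+1}}) x y : x < y -> y <= n ->
  y = x.+1 \/ x = 0 /\ y = n -> edges D x y.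
Proof.
move=> xy yn out; rewrite /edges /graph_edge outer_edge_seg !inordK; lia.
Qed.

Lemma edges_inner n (D : {set {set 'I_n.+1}}) x y : x.+1 < y -> y <= n ->
  ~ (x = 0 /\ y = n) -> edges D x y -> seg (inord x) (inord y) \in D.
Proof.
move=> xy yn out; rewrite /edges /graph_edge => /orP[|//].
rewrite outer_edge_seg !inordK; lia.
Qed.

(** Crossing diagonals (a, c) and (b, d) can be given with their endpoints in any
    order.  The conclusion is invariant under the exchanges of a and c and of b
    and d, which reduces to a < c and b < d. *)
Lemma framed_edges (R : realFieldType) n (p : 'I_n.+1 -> 'rV[R]_2)
    (D : {set {set 'I_n.+1}}) :
  convex_polygon p -> dissection D ->
  diagonally_framed p D <-> framed n (edges D).
Proof.
move=> hp /forall_inP dD; split=> [fD i j k l ij jk kl ln Eik Ejl|fE].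
  have [] := fD (inord i) (inord j) (inord k) (inord l).
  - by apply: edges_inner Eik; lia.
  - by apply: edges_inner Ejl; lia.
  - by apply: interleaved_cross; rewrite // !inordK; lia.
  by move=> *; split=> //; rewrite /edges graph_edge_sym.
have core (a b c d : 'I_n.+1) : a < c -> b < d -> seg a c \in D -> seg b d \in D ->
    cross p a c b d ->
    [/\ graph_edge D a b, graph_edge D b c, graph_edge D c d & graph_edge D d a].
  move=> ac bd Dac Dbd /(cross_interleaved hp ac bd).
  have Eac : edges D a c by rewrite edges_ord /graph_edge Dac orbT.
  have Ebd : edges D b d by rewrite edges_ord /graph_edge Dbd orbT.
  case/orP=> /andP[/andP[ab bc] cd].
    have := fE _ _ _ _ ab bc cd (ltn_ord d) Eac Ebd.
    by rewrite !edges_ord (graph_edge_sym D d).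
  have := fE _ _ _ _ ab bc cd (ltn_ord c) Ebd Eac.
  by rewrite !edges_ord => -[? ? ? ?]; split; rewrite // graph_edge_sym.
have neq (i j : 'I_n.+1) : seg i j \in D -> i < j \/ j < i.
  move=> /dD/andP[]; rewrite cards2; case: (i =P j) => // ij _ _.
  have {}ij : i <> j :> nat by move/val_inj.
  lia.
have crossC (a c b d : 'I_n.+1) : cross p a c b d -> cross p c a b d.
  by rewrite /cross seg_sym open_segment_sym.
have crossC' (a c b d : 'I_n.+1) : cross p a c b d -> cross p a c d b.
  by rewrite /cross (seg_sym b) (open_segment_sym (p b)).
move=> a b c d Dac Dbd cr; have Dca := Dac; have Ddb := Dbd.
rewrite seg_sym in Dca; rewrite seg_sym in Ddb.
case: (neq _ _ Dac) => ac; case: (neq _ _ Dbd) => bd.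
- exact: core.
- have [] := core a d c b ac bd Dac Ddb (crossC' _ _ _ _ cr).
  by move=> ? ? ? ?; split; rewrite // graph_edge_sym.
- have [] := core c b a d ac bd Dca Dbd (crossC _ _ _ _ cr).
  by move=> ? ? ? ?; split; rewrite // graph_edge_sym.
- have [] := core c d a b ac bd Dca Ddb (crossC _ _ _ _ (crossC' _ _ _ _ cr)).
  by split.
Qed.

Lemma quad_free_edges n (D : {set {set 'I_n.+1}}) :
  (~ exists a b c d : 'I_n.+1, quadrilateral D a b c d) <-> quad_free n (edges D).
Proof.
split=> [noq i j k l ij jk kl ln Eij Ejk Ekl Eil|qf [a [b [c [d]]]]].
  have [Eik|nEik] := boolP (graph_edge D (inord i) (inord k)); first by left.
  have [Ejl|nEjl] := boolP (graph_edge D (inord j) (inord l)); first by right.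
  exfalso; apply: noq; exists (inord i), (inord j), (inord k), (inord l).
  by split; [split; rewrite !inordK; lia|].
move=> [[ab bc cd] [[Eab Ebc Ecd Ead] [ac bd]]].
have := qf _ _ _ _ ab bc cd (ltn_ord d).
rewrite !edges_ord => /(_ Eab Ebc Ecd Ead).
by rewrite (negPf ac) (negPf bd) => -[].
Qed.

Lemma Phi_dissection n (P : {set {set 'I_n}}) : dissection (Phi P).
Proof. by apply/forall_inP => e; rewrite inE => /andP[]. Qed.

(** The outer edges are the singletons and the set of all values, which are
    modules of every order. *)
Lemma edges_Phi n (s : 'S_n) (lt : rel nat) x y :
    (forall x y : 'I_n, lt x y = ((s^-1)%g x < (s^-1)%g y)) ->
    x < y -> y <= n ->
  edges (Phi (interval_poset s)) x y <-> is_module lt 0 n x y.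
Proof.
move=> ltE xy yn.
have xn : x < n by lia.
have y1n : y.-1 < n by lia.
have mod_itv : itv (Ordinal xn) (Ordinal y1n) \in interval_poset s <-> is_module lt 0 n x y.
  rewrite (interval_poset_module ltE) /=; last lia.
  by rewrite prednK //; lia.
have [out|/not_orP[yx1 xyn]] := EM (y = x.+1 \/ x = 0 /\ y = n).
  split=> _; last exact: edges_outer.
  move=> u v z xu xv zn; case: out => [yx _|[x0 yE]]; last by rewrite x0 yE zn.
  by congr lt; lia.
rewrite -mod_itv; split=> [/edges_inner|xyP].
  rewrite inE => /(_ ltac:(lia) yn xyn) /andP[_] /existsP[a /existsP[b /and3P[ab abP]]].
  move/eqP/seg_inj; rewrite !inordK /=; try lia.
  move=> /(_ ltac:(lia) ltac:(rewrite /bump; lia)) [/(congr1 val) /= xa /(congr1 val) /= yb].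
  rewrite !inordK in xa yb; try lia.
  have -> : Ordinal xn = a by apply: val_inj => /=; lia.
  by have -> : Ordinal y1n = b by apply: val_inj => /=; rewrite /bump in yb; lia.
rewrite /edges /graph_edge inE diagonal_seg ?inordK; try lia.
case: outer_edge => //=.
apply/existsP; exists (Ordinal xn); apply/existsP; exists (Ordinal y1n).
apply/and3P; split=> //=; first lia.
by apply/eqP; congr seg; apply: val_inj; rewrite /= inordK // /bump; lia.
Qed.

(** * The bijection *)

Lemma interval_poset_edges n (s : 'S_n) (a b : 'I_n) : a <= b ->
  itv a b \in interval_poset s <-> edges (Phi (interval_poset s)) a b.+1.
Proof.
move=> ab; have [lt [so ltE]] := perm_order s.
by rewrite (interval_poset_module ltE ab) (edges_Phi ltE).
Qed.

Lemma Phi_interval_poset_inj n (s1 s2 : 'S_n) :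
  Phi (interval_poset s1) = Phi (interval_poset s2) ->
  interval_poset s1 = interval_poset s2.
Proof.
move=> e; apply/setP => I.
have [/existsP[a /existsP[b /andP[ab /eqP->]]]|nI] := boolP (consecutive I).
  have [to1 from1] := interval_poset_edges s1 ab.
  have [to2 from2] := interval_poset_edges s2 ab.
  apply/idP/idP => [/to1|/to2]; first by rewrite e => /from2.
  by rewrite -e => /from1.
by rewrite !inE /is_interval (negPf nI).
Qed.

Lemma exists_interval_poset n (D : {set {set 'I_n.+1}}) :
    1 < n -> dissection D -> framed n (edges D) -> quad_free n (edges D) ->
  exists s : 'S_n, Phi (interval_poset s) = D.
Proof.
move=> n1 dD fD qD.
have Exx x : x < n -> edges D x x.+1 by move=> xn; apply: edges_outer; lia.
have E0n : edges D 0 n by apply: edges_outer; lia.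
have [lt [so re]] := exists_realizing_order fD qD Exx (ltnW n1) (leqnn n) E0n.
have [s ltE] := order_perm n so; exists s.
apply: dissection_eq => //; first exact: Phi_dissection.
move=> i j ij; have jn : j <= n by have := ltn_ord j; lia.
by apply/idP/idP; rewrite -!edges_ord (edges_Phi ltE) // (re i j).
Qed.

Theorem theorem3p11 (R : realFieldType) (n : nat) (p : 'I_n.+1 -> 'rV[R]_2)
    (hn : 2 <= n) (hp : convex_polygon p) :
  set_bij (interval_posets n) (framed_quad_free_dissections p) (@Phi n) /\
  (interval_posets n #= framed_quad_free_dissections p)%card.
Proof.
have bij : set_bij (interval_posets n) (framed_quad_free_dissections p) (@Phi n).
  split=> [_ [s ->]|P1 P2|D [dD fD nq]].
  - have [lt [so ltE]] := perm_order s.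
    have edgesE x y : x < y -> y <= n ->
        edges (Phi (interval_poset s)) x y = is_module lt 0 n x y.
      by move=> xy yn; apply/propext/edges_Phi.
    have dP := Phi_dissection (interval_poset s).
    split=> //; first apply/framed_edges => //.
      move=> i j k l ij jk kl ln; rewrite !edgesE; try lia.
      exact: (framed_module so ij jk kl ln).
    apply/quad_free_edges => i j k l ij jk kl ln; rewrite !edgesE; try lia.
    exact: (quad_free_module so ij jk kl ln).
  - by move=> /[!inE] -[s1 ->] [s2 ->]; exact: Phi_interval_poset_inj.
  - have [s sD] := exists_interval_poset hn dD ((framed_edges hp dD).1 fD)
      ((quad_free_edges D).1 nq).
    by exists (interval_poset s) => //; exists s.
split=> //; have [f _] := Pbij bij.
exact: pcard_eq f.
Qed.
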